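(* Suppose that the explicit standard Runge-Kutta method $(A,b^T,h)$ has accuracy order $p$. If the denominator function $\varphi$ satisfies $$\varphi(h)=h+\mathcal{O}(h^{p+1}),\qquad h\to 0,$$ then the explicit nonstandard Runge-Kutta method $(A,b^T,\varphi)$ also has accuracy order $p$.
   Context: Let $s\ge 1$, let $A=(a_{ij})_{s\times s}$ be a real matrix with $a_{ij}=0$ for $j\ge i$, and let $b=(b_1,\ldots,b_s)\in\mathbb{R}^s$. Let $\varphi$ be a positive function of the step size $h>0$ (the denominator function). The explicit nonstandard Runge-Kutta (ENRK) method $(A,b^T,\varphi)$ for an autonomous system $\frac{dy}{dt}=f(y)$, $f:\mathbb{R}^n\to\mathbb{R}^n$, with step size $h>0$ (approximating the solution at $t_k=t_0+kh$) is the one-step scheme $$K_1=f(y_k),\quad K_i=f\Big(y_k+\varphi(h)\sum_{j=1}^{i-1}a_{ij}K_j\Big)\ (2\le i\le s),\qquad \frac{y_{k+1}-y_k}{\varphi(h)}=b_1K_1+\cdots+b_sK_s .$$ The choice $\varphi(h)=h$ gives the explicit standard Runge-Kutta (ESRK) method $(A,b^T,h)$. Accuracy order is understood in the classical sense of order conditions based on Taylor expansion: a method (ESRK or ENRK) has accuracy order $p$ ($p\ge1$) if for every sufficiently smooth $f$, the result $y_1$ of one step of step size $h$ starting from $y_0=y(t_0)$ satisfies $y(t_0+h)-y_1=\mathcal{O}(h^{p+1})$ as $h\to 0$, where $y$ is the exact solution of $\frac{dy}{dt}=f(y)$. *)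

(* Defs.v *)
From HB Require Import structures.
From mathcomp Require Export all_boot all_order all_algebra.
From mathcomp Require Export boolp classical_sets functions reals topology
  normedtype landau derive.
Export Order.TTheory GRing.Theory Num.Theory.
Export numFieldNormedType.Exports.
Set Implicit Arguments.
Unset Strict Implicit.
Unset Printing Implicit Defensive.
#[export] Set Implicit Arguments.
#[export] Unset Strict Implicit.
#[export] Unset Printing Implicit Defensive.

Local Open Scope ring_scope.
Local Open Scope classical_set_scope.

(* Functions of class C^m on R^n, by recursion on m.  In finite dimension,
   continuity of the differential is equivalent to continuity of all the
   directional derivatives of an everywhere differentiable function. *)
Fixpoint class_C (R : realType) (n m : nat) (f : 'rV[R]_n -> 'rV[R]_n) : Prop :=
  match m with
  | 0 => continuous f
  | m'.+1 => (forall x, differentiable f x) /\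
             (forall v, class_C m' (fun x => 'D_v f x))
  end.

(* The right-hand sides of the stage equations (indices start at 0). *)
Definition rk_stage_map (R : realType) (s n : nat) (A : 'M[R]_s)
    (f : 'rV[R]_n -> 'rV[R]_n) (tau : R) (y : 'rV[R]_n)
    (K : 'I_s -> 'rV[R]_n) (i : 'I_s) : 'rV[R]_n :=
  f (y + tau *: \sum_(j < s | (j < i)%N) A i j *: K j).

(* The i-th stage depends on the previous ones only, so s iterations from any
   starting point reach the unique solution of the stage equations: see
   rk_stageE and rk_stage_unique. *)
Definition rk_stage (R : realType) (s n : nat) (A : 'M[R]_s)
    (f : 'rV[R]_n -> 'rV[R]_n) (tau : R) (y : 'rV[R]_n) : 'I_s -> 'rV[R]_n :=
  iter s (rk_stage_map A f tau y) (fun=> 0).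

(* One step, of step size h and starting from y, of the explicit method
   (A, b^T, phi); the standard method is the case phi = id. *)
Definition enrk_step (R : realType) (s n : nat) (A : 'M[R]_s) (b : 'rV[R]_s)
    (phi : R -> R) (f : 'rV[R]_n -> 'rV[R]_n) (h : R) (y : 'rV[R]_n) :
    'rV[R]_n :=
  y + phi h *: \sum_(i < s) b 0 i *: rk_stage A f (phi h) y i.

(* "For every sufficiently smooth f" is rendered as: for some m, for every f of
   class C^m, in every dimension n.  The exact solution y is only required to
   satisfy y' = f(y) near t0, since solutions need not be global. *)
Definition has_accuracy_order (R : realType) (s : nat) (A : 'M[R]_s)
    (b : 'rV[R]_s) (phi : R -> R) (p : nat) : Prop :=
  exists m : nat, forall (n : nat) (f : 'rV[R]_n -> 'rV[R]_n), class_C m f ->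
  forall (t0 : R) (y : R -> 'rV[R]_n),
    (\forall t \near t0, is_derive (t : R) (1 : R) y (f (y t))) ->
    (fun h => y (t0 + h) - enrk_step A b phi f h (y t0))
      =O_ (0^'+) (fun h : R => h ^+ p.+1).

Lemma rk_stage_iter_eq (R : realType) (s n : nat) (A : 'M[R]_s)
    (f : 'rV[R]_n -> 'rV[R]_n) tau y (K : 'I_s -> 'rV[R]_n) (k : nat) :
  (forall i, K i = rk_stage_map A f tau y K i) ->
  forall K0 (i : 'I_s), (i < k)%N ->
  iter k (rk_stage_map A f tau y) K0 i = K i.
Proof.
move=> KE K0; elim: k => [|k IH] i //= ik.
rewrite KE /rk_stage_map; congr (f (_ + _ *: _)).
by apply: eq_bigr => j ji; rewrite IH// (leq_trans ji).
Qed.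

Lemma rk_stage_iter_stable (R : realType) (s n : nat) (A : 'M[R]_s)
    (f : 'rV[R]_n -> 'rV[R]_n) tau y (k : nat) (K0 K1 : 'I_s -> 'rV[R]_n)
    (i : 'I_s) : (i < k)%N ->
  iter k (rk_stage_map A f tau y) K0 i = iter k (rk_stage_map A f tau y) K1 i.
Proof.
elim: k i => [|k IH] i //= ik.
rewrite /rk_stage_map; congr (f (_ + _ *: _)).
by apply: eq_bigr => j ji; rewrite IH// (leq_trans ji).
Qed.

Lemma rk_stageE (R : realType) (s n : nat) (A : 'M[R]_s)
    (f : 'rV[R]_n -> 'rV[R]_n) (tau : R) (y : 'rV[R]_n) (i : 'I_s) :
  rk_stage A f tau y i =
  f (y + tau *: \sum_(j < s | (j < i)%N) A i j *: rk_stage A f tau y j).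
Proof.
rewrite -[RHS]/(rk_stage_map A f tau y (rk_stage A f tau y) i) /rk_stage.
by rewrite -iterS iterSr; apply: rk_stage_iter_stable.
Qed.

Lemma rk_stage_unique (R : realType) (s n : nat) (A : 'M[R]_s)
    (f : 'rV[R]_n -> 'rV[R]_n) (tau : R) (y : 'rV[R]_n)
    (K : 'I_s -> 'rV[R]_n) :
  (forall i, K i = f (y + tau *: \sum_(j < s | (j < i)%N) A i j *: K j)) ->
  forall i, K i = rk_stage A f tau y i.
Proof. by move=> KE i; rewrite [RHS](rk_stage_iter_eq KE). Qed.

Lemma enrk_stepE (R : realType) (s n : nat) (A : 'M[R]_s) (b : 'rV[R]_s)
    (phi : R -> R) (f : 'rV[R]_n -> 'rV[R]_n) (h : R) (y z : 'rV[R]_n) :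
  0 < phi h ->
  z = enrk_step A b phi f h y <->
  (phi h)^-1 *: (z - y) = \sum_(i < s) b 0 i *: rk_stage A f (phi h) y i.
Proof.
move=> /lt0r_neq0 h0; rewrite /enrk_step; split=> [->|<-].
  by rewrite addrC addKr scalerA mulVf// scale1r.
by rewrite scalerA mulfV// scale1r addrC subrK.
Qed.

(* Main.v *)
Require Import Defs.
Local Open Scope ring_scope.
Local Open Scope classical_set_scope.

(** One step of the method is y + g(phi(h)), where
      g(tau) = tau * (b_1 K_1(tau) + ... + b_s K_s(tau))
    depends on the step size through tau alone. The standard and nonstandard
    steps started at the same point therefore differ by g(h) - g(phi(h)). If g
    is Lipschitz near 0, this is at most a constant times |phi(h) - h|, hence
    O(h^(p+1)); added to the error of the standard method, which is O(h^(p+1))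
    by assumption, it leaves the order unchanged.

    It remains to see that g is Lipschitz near 0. A field f of class C^1 is
    Lipschitz near every point ([class_C1_lipschitz_near]), by the mean value
    inequality and a local bound on its directional derivatives. Functions
    that are Lipschitz near a point are stable under the operations that
    build the stages, so induction on the stage number gives the property for
    each K_i ([rk_stage_lipschitz_near]), and then for g.

    The smoothness required of f goes from C^m for the standard method to
    C^(m+1) for the nonstandard one: this guarantees C^1 even when m = 0. *)

(** * Functions that are Lipschitz near a point *)

Lemma lipschitz_onP (K : numFieldType) (V W : normedModType K) (f : V -> W)
    (F : set_system (V * V)) {FF : ProperFilter F} :
  lipschitz_on f F <->
  exists2 k : K, 0 < k & \forall z \near F, `|f z.1 - f z.2| <= k * `|z.1 - z.2|.
Proof.
split=> [/pinfty_ex_gt0[k k0 fk]|[k k0 fk]]; first by exists k.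
exact: (klipschitzW (k := k)).
Qed.

(** Two points vary independently near x: differentiability at x alone would
    only compare f z with f x, whereas the two stages being compared are both
    moving. *)
Definition lipschitz_near (R : realType) (V W : normedModType R) (f : V -> W)
    (x : V) := lipschitz_on f (nbhs (x, x)).

Section LipschitzNear.
Context (R : realType) (V W : normedModType R).
Implicit Types (f g : V -> W) (x : V).

Lemma lipschitz_near_cst (a : W) x : lipschitz_near (fun=> a) x.
Proof.
apply/lipschitz_onP; exists 1 => //; apply: nearW => z.
by rewrite subrr normr0 mul1r.
Qed.

Lemma lipschitz_nearD f g x :
  lipschitz_near f x -> lipschitz_near g x ->
  lipschitz_near (fun z => f z + g z) x.
Proof.
move=> /lipschitz_onP[k k0 fk] /lipschitz_onP[l l0 gl].
apply/lipschitz_onP; exists (k + l); first exact: addr_gt0.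
apply: filterS2 fk gl => z fz gz.
by rewrite opprD addrACA mulrDl (le_trans (ler_normD _ _))// lerD.
Qed.

Lemma lipschitz_near_sum (I : Type) (r : seq I) (P : pred I) (F : I -> V -> W)
    x : (forall i, P i -> lipschitz_near (F i) x) ->
  lipschitz_near (fun z => \sum_(i <- r | P i) F i z) x.
Proof.
move=> FL.
rewrite (_ : (fun z => _) = \sum_(i <- r | P i) F i); last first.
  by apply/funext => z; rewrite fct_sumE.
elim/big_ind : _ => // [|f g fL gL]; first exact: lipschitz_near_cst.
exact: lipschitz_nearD.
Qed.

Lemma lipschitz_nearZ (a : R) f x :
  lipschitz_near f x -> lipschitz_near (fun z => a *: f z) x.
Proof.
move=> /lipschitz_onP[k k0 fk]; apply/lipschitz_onP.
exists ((`|a| + 1) * k); first by rewrite mulr_gt0 ?ltr_wpDl.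
apply: filterS fk => z fz; rewrite -scalerBr normrZ -mulrA.
by apply: ler_pM => //; rewrite lerDl.
Qed.

Lemma lipschitz_near_continuous f x : lipschitz_near f x -> f z @[z --> x] --> f x.
Proof.
move=> /lipschitz_onP[k k0 fk]; apply/cvgrPdist_lt => e e0.
have : \forall z \near x, `|f x - f z| <= k * `|x - z|.
  have c : (x, z) @[z --> x] --> (x, x) by apply: cvg_pair => //; exact: cvg_cst.
  exact: c fk.
apply: filterS2 (_ : \forall z \near x, `|x - z| < e / k) => [z|].
  by move=> xz /le_lt_trans; apply; rewrite mulrC -ltr_pdivlMr.
by apply: cvgr_dist_lt => //; rewrite divr_gt0.
Qed.

End LipschitzNear.

Lemma lipschitz_near_comp (R : realType) (U V W : normedModType R) (f : V -> W)
    (g : U -> V) (x : U) :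
  lipschitz_near g x -> lipschitz_near f (g x) ->
  lipschitz_near (fun z => f (g z)) x.
Proof.
move=> gL /lipschitz_onP[k k0 fk].
have gx := lipschitz_near_continuous gL.
move: gL => /lipschitz_onP[l l0 gl].
apply/lipschitz_onP; exists (k * l); first exact: mulr_gt0.
have {fk} : \forall z \near (x, x),
    `|f (g z.1) - f (g z.2)| <= k * `|g z.1 - g z.2|.
  have c : (g z.1, g z.2) @[z --> (x, x)] --> (g x, g x).
    by apply: cvg_pair; apply: cvg_comp gx; [exact: cvg_fst|exact: cvg_snd].
  exact: c fk.
apply: filterS2 gl => z gz /le_trans; apply.
by rewrite -mulrA ler_pM2l.
Qed.

(** The product of two locally Lipschitz functions is handled by
    a f(a) - b f(b) = a (f(a) - f(b)) + (a - b) f(b), in which a and f(b) stay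
    bounded near 0. *)
Lemma lipschitz_near_smul0 (R : realType) (W : normedModType R) (f : R -> W) :
  lipschitz_near f 0 -> lipschitz_near (fun t : R => t *: f t) 0.
Proof.
move=> fL; have f0 := lipschitz_near_continuous fL.
move: fL => /lipschitz_onP[k k0 fk]; apply/lipschitz_onP.
exists (k + (`|f 0| + 1)); first by rewrite addr_gt0 ?ltr_wpDl.
have z1 : z.1 @[z --> (0 : R, 0 : R)] --> (0 : R) by exact: cvg_fst.
have z2 : z.2 @[z --> (0 : R, 0 : R)] --> (0 : R) by exact: cvg_snd.
have b1 : \forall z \near (0 : R, 0 : R), `|z.1| <= 1.
  exact: (cvgr0_norm_le _ z1 _ ltr01).
have b2 : \forall z \near (0 : R, 0 : R), `|f z.2| <= `|f 0| + 1.
  by apply: (cvgr_norm_le _ (cvg_comp _ _ z2 f0)); rewrite ltrDl.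
apply: filterS3 fk b1 b2 => -[a b] /= fab a1 fb.
have -> : a *: f a - b *: f b = a *: (f a - f b) + (a - b) *: f b.
  by rewrite scalerBr scalerBl addrA subrK.
rewrite (le_trans (ler_normD _ _))// mulrDl !normrZ lerD//.
  by rewrite -[leRHS]mul1r ler_pM.
by rewrite mulrC ler_wpM2r.
Qed.

(** * Functions of class C^1 are locally Lipschitz *)

Section ClassC1.
Context (R : realType) (n : nat).
Implicit Types f : 'rV[R]_n -> 'rV[R]_n.

Lemma ler_coord_norm (v : 'rV[R]_n) i : `|v 0 i| <= `|v|.
Proof. by rewrite [leRHS]/Num.Def.normr/= mx_normrE (le_bigmax _ _ (0, i)). Qed.

Lemma class_CS m f : class_C m.+1 f -> class_C m f.
Proof.
elim: m f => [|m IH] f [df Df]; first by move=> x; exact: differentiable_continuous.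
by split=> // v; exact: IH.
Qed.

Lemma class_C_le m k f : (m <= k)%N -> class_C k f -> class_C m f.
Proof.
by move=> /subnK <-; elim: (k - m)%N => [|d IH]//; rewrite addSn => /class_CS.
Qed.

(** Expanding w in the canonical basis bounds the operator norm of the
    differential by the n functions of x that [class_C] requires to be
    continuous, uniformly in the direction w. *)
Lemma derive_norm_le f x w : differentiable f x ->
  `|'D_w f x| <= (\sum_(j < n) `|'D_(delta_mx 0 j) f x|) * `|w|.
Proof.
move=> df; rewrite deriveE// [X in 'd f x X]row_sum_delta linear_sum/=.
rewrite (le_trans (ler_norm_sum _ _ _))// mulr_suml ler_sum// => j _.
by rewrite linearZ/= normrZ -deriveE// mulrC ler_wpM2l// ler_coord_norm.
Qed.

Lemma is_derive_line_coord f v w (i : 'I_n) (t : R) :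
  differentiable f (t *: w + v) ->
  is_derive t (1 : R) (fun s : R => f (s *: w + v) 0 i) ('D_w f (t *: w + v) 0 i).
Proof.
move=> /(@diff_derivable _ _ _ _ _ w) df.
have dline : is_derive t (1 : R) (fun s : R => f (s *: w + v)) ('D_w f (t *: w + v)).
  have E : (fun h : R => h^-1 *: (((fun s => f (s *: w + v)) \o shift t) (h *: 1)
           - f (t *: w + v)))
         = (fun h : R => h^-1 *: ((f \o shift (t *: w + v)) (h *: w)
           - f (t *: w + v))).
    by apply/funext => h /=; rewrite scalerDl addrA [h *: 1]mulr1.
  by split; rewrite /derivable /derive E.
have [dl El] := dline; have := derive_mx dl.
rewrite El => ->; rewrite mxE; apply/derivableP.
exact: (derivable_mxP _ _ _).1.
Qed.

(** The scalar mean value theorem is applied to each coordinate separately; no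
    constant is lost because the norm is the maximum of the coordinates. *)
Lemma mean_value_ineq f v w (M : R) :
  (forall x, differentiable f x) ->
  (forall t, t \in `[0, 1]%R -> `|'D_w f (t *: w + v)| <= M) ->
  `|f (w + v) - f v| <= M.
Proof.
move=> df fM.
have M0 : 0 <= M by apply: le_trans (fM 0 _); rewrite // bound_itvE.
rewrite [leLHS]/Num.Def.normr/= mx_normrE (bigmax_le _ M0)// => -[a i] _ /=.
rewrite (ord1 a) !mxE.
have D (t : R) := is_derive_line_coord (w := w) (v := v) i (df (t *: w + v)).
have [|t t01 E] := @MVT_segment R (fun s => f (s *: w + v) 0 i)
    (fun s => 'D_w f (s *: w + v) 0 i) 0 1 ler01 (fun t _ => D t).
  apply: continuous_subspaceT => t.
  by apply: differentiable_continuous; apply/derivable1_diffP; have [] := D t.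
move: E; rewrite scale1r scale0r add0r subr0 mulr1 => ->.
exact: le_trans (ler_coord_norm _ _) (fM _ t01).
Qed.

(** The sum S of the norms of the partial derivatives is continuous, hence at
    most S(x) + 1 on some ball around x; balls being convex, the mean value
    inequality applies to the segment between any two points of it. *)
Lemma class_C1_lipschitz_near f x : class_C 1 f -> lipschitz_near f x.
Proof.
move=> [df Df].
pose S z := \sum_(j < n) `|'D_(delta_mx 0 j) f z|.
have Sx : S z @[z --> x] --> S x.
  apply: (@cvg_big _ _ _ _ _ _ _ (nbhs x)) => [|j _]; first exact: add_continuous.
  by apply: cvg_norm; exact: Df.
have S0 : 0 <= S x by exact: sumr_ge0.
have /nbhs_ballP[e /= e0 eS] : \forall z \near x, S z <= S x + 1.
  by apply: (cvgr_le _ Sx); rewrite ltrDl.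
apply/lipschitz_onP; exists (S x + 1); first by rewrite ltr_wpDl.
have xe : nbhs x (ball x e) by exact: nbhsx_ballx.
have : \forall z \near (x, x), ball x e z.1 /\ ball x e z.2.
  by exists (ball x e, ball x e).
apply: filterS => -[u v] /= [xu xv].
rewrite -{1}(subrK v u); apply: mean_value_ineq => // t t01.
rewrite (le_trans (derive_norm_le _ _))// ler_wpM2r//; apply: eS.
move: t01; rewrite in_itv/= => /andP[t0 t1].
move: xu xv; rewrite -ball_normE/= => xu xv.
have -> : x - (t *: (u - v) + v) = t *: (x - u) + (1 - t) *: (x - v).
  rewrite [in RHS]scalerBl scale1r addrCA -scalerBr opprB [x - u + _]addrC subrKA.
  by rewrite opprD -scalerN opprB addrCA addrC.
rewrite (le_lt_trans (ler_normD _ _))// !normrZ ger0_norm// ger0_norm ?subr_ge0//.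
(* A convex combination of the two distances is at most their maximum. *)
have : Num.max `|x - u| `|x - v| < e by rewrite gt_max xu.
apply: le_lt_trans; set M := Num.max _ _.
rewrite [leRHS](_ : _ = t * M + (1 - t) * M); last by rewrite -mulrDl subrKC mul1r.
rewrite lerD// ler_wpM2l ?subr_ge0//.
  by rewrite le_max lexx.
by rewrite le_max lexx orbT.
Qed.

End ClassC1.

(** * Dependence of the method on the denominator function *)

(** Explicitness is what makes the strong induction on i work: by [rk_stageE],
    the i-th stage is f composed with a combination of earlier stages. *)
Lemma rk_stage_lipschitz_near (R : realType) (s n : nat) (A : 'M[R]_s)
    (f : 'rV[R]_n -> 'rV[R]_n) (y : 'rV[R]_n) (i : 'I_s) :
  (forall x, lipschitz_near f x) ->
  lipschitz_near (fun tau : R => rk_stage A f tau y i) 0.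
Proof.
move=> fL; have [m] := ubnP (i : nat); elim: m i => // m IH i im.
under [X in lipschitz_near X]eq_fun do rewrite rk_stageE.
pose g tau := y + tau *: \sum_(j < s | (j < i)%N) A i j *: rk_stage A f tau y j.
apply: (@lipschitz_near_comp _ _ _ _ f g); last exact: fL.
apply: lipschitz_nearD; first exact: lipschitz_near_cst.
apply: lipschitz_near_smul0; apply: lipschitz_near_sum => j ji.
by apply: lipschitz_nearZ; apply: IH; exact: leq_trans ji _.
Qed.

(** Ensures that phi(h) eventually enters the neighbourhood of 0 on which the
    increment of the method is Lipschitz. *)
Lemma cvg_at_right_of_bigO (R : realType) (phi : R -> R) (p : nat) :
  (fun h : R => phi h - h) =O_ (0^'+) (fun h : R => h ^+ p.+1) ->
  phi h @[h --> 0^'+] --> (0 : R).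
Proof.
move=> /eqO_exP[k k0 kphi].
have id0 : h @[h --> (0 : R)^'+] --> (0 : R) by apply: cvg_at_right_filter; exact: cvg_id.
have d0 : (phi h - h) @[h --> 0^'+] --> (0 : R).
  apply/norm_cvg0P.
  apply: (@squeeze_cvgr _ _ _ _ (fun=> 0) (fun h => k * `|h|)).
  (* For |h| <= 1, |h^(p+1)| <= |h|, so k |h| is a majorant tending to 0. *)
  - apply: filterS2 kphi (cvgr0_norm_le _ id0 _ ltr01) => h /le_trans kh h1.
    rewrite normr_ge0 kh// ler_pM2l// normrX exprS ler_piMr//.
    exact: exprn_ile1.
  - exact: cvg_cst.
  - rewrite -[X in _ --> X](mulr0 k); apply: cvgMl_tmp.
    exact/norm_cvg0P.
rewrite -[X in _ --> X]addr0 (_ : phi = fun h => (phi h - h) + h).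
  exact: cvgD.
by apply/funext => h; rewrite subrK.
Qed.

Theorem theorem3 (R : realType) (s : nat) (A : 'M[R]_s) (b : 'rV[R]_s)
    (phi : R -> R) (p : nat)
    (s_ge1 : (1 <= s)%N)
    (A_explicit : forall i j : 'I_s, (i <= j)%N -> A i j = 0)
    (phi_gt0 : forall h : R, 0 < h -> 0 < phi h)
    (p_ge1 : (1 <= p)%N)
    (esrk_order : has_accuracy_order A b id p)
    (phi_asymptotics :
      (fun h : R => phi h - h) =O_ (0^'+) (fun h : R => h ^+ p.+1)) :
  has_accuracy_order A b phi p.
Proof.
have [m ordm] := esrk_order; exists m.+1 => n f Cf t0 y y_sol.
have {}ordm := ordm n f (class_CS Cf) t0 y y_sol.
have fL x : lipschitz_near f x.
  by apply: class_C1_lipschitz_near; exact: class_C_le Cf.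
pose g tau := tau *: \sum_(i < s) b 0 i *: rk_stage A f tau (y t0) i.
have gL : lipschitz_near g 0.
  apply: lipschitz_near_smul0; apply: lipschitz_near_sum => i _.
  by apply: lipschitz_nearZ; exact: rk_stage_lipschitz_near.
move: gL => /lipschitz_onP[k k0 gk].
have phi0 := cvg_at_right_of_bigO phi_asymptotics.
have h0 : h @[h --> (0 : R)^'+] --> (0 : R).
  by apply: cvg_at_right_filter; exact: cvg_id.
have hphi : (h, phi h) @[h --> 0^'+] --> (0 : R, 0 : R).
  exact: (cvg_pair h0 phi0).
have {}gk : \forall h \near 0^'+, `|g h - g (phi h)| <= k * `|h - phi h|.
  exact: hphi gk.
have [c c0 phic] := (eqO_exP _ _ _).1 phi_asymptotics.
have [d d0 ordd] := (eqO_exP _ _ _).1 ordm.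
apply/eqO_exP; exists (d + k * c); first by rewrite addr_gt0// mulr_gt0.
apply: filterS3 gk phic ordd => h gh phih ordh.
have -> : y (t0 + h) - enrk_step A b phi f h (y t0) =
    (y (t0 + h) - enrk_step A b id f h (y t0)) + (g h - g (phi h)).
  by rewrite /enrk_step -/(g _) -/(g _) !opprD !addrA subrK.
rewrite (le_trans (ler_normD _ _))// mulrDl lerD// (le_trans gh)//.
by rewrite -mulrA ler_pM2l// distrC.
Qed.
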